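(* Let $R$ be a non-zero ring with $2\in J(R)$ and let $G$ be a group. If the group ring $RG$ is a 2-UQ ring, then $G$ is a 2-group.
   Context: Rings are associative with unity, not necessarily commutative. $J(R)$ is the Jacobson radical and $U(R)$ the set of units of $R$. An element $a\in R$ is quasi-nilpotent if $1-ax$ is invertible for every $x\in R$ with $ax=xa$; $QN(R)$ is the set of quasi-nilpotent elements. $R$ is 2-UQ if the square of each unit is the sum of an idempotent and a quasi-nilpotent element that commute with each other; equivalently, for each $u\in U(R)$, $u^2=1+q$ with $q\in QN(R)$. For a prime $p$, a group is a $p$-group if the order of each of its elements is a (finite) power of $p$. $RG$ denotes the group ring of $G$ over $R$. *)

(* Defs.v *)
From HB Require Import structures.
From mathcomp Require Import all_boot all_algebra finmap monalg.
From mathcomp Require Import classical_sets.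

Set Implicit Arguments.
Unset Strict Implicit.
Unset Printing Implicit Defensive.

Import GRing.Theory.
Local Open Scope fset_scope.
Local Open Scope ring_scope.

Section RingNotions.
Variable S : pzRingType.
Implicit Types (I : set S) (a u : S).

Record left_ideal I : Prop := LeftIdeal {
  left_ideal0 : I 0;
  left_idealD : forall x y, I x -> I y -> I (x + y);
  left_idealM : forall r x, I x -> I (r * x)
}.

Definition maximal_left_ideal I : Prop :=
  [/\ left_ideal I, I <> setT &
      forall K : set S, left_ideal K -> subset I K -> K <> setT -> K = I].

(* In the zero ring there is no maximal left ideal and J(S) = S. *)
Definition jacobson : set S :=
  [set a | forall I, maximal_left_ideal I -> I a]%classic.

(* Invertibility is two-sided; [GRing.unit] would require a [unitRingType]. *)
Definition units : set S :=
  [set u | exists v, u * v = 1 /\ v * u = 1]%classic.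

Definition quasi_nilpotent : set S :=
  [set a | forall x, a * x = x * a -> units (1 - a * x)]%classic.

Definition two_UQ : Prop :=
  forall u, units u -> exists e q,
    [/\ e * e = e, quasi_nilpotent q, e * q = q * e & u ^+ 2 = e + q].

End RingNotions.

Arguments jacobson S : clear implicits.
Arguments units S : clear implicits.
Arguments quasi_nilpotent S : clear implicits.

Section GroupNotions.
Variable G : groupType.

Definition has_order (x : G) (n : nat) : Prop :=
  [/\ (0 < n)%N, (x ^+ n)%g = 1%g &
      forall m, (0 < m)%N -> (x ^+ m)%g = 1%g -> (n <= m)%N].

End GroupNotions.

Definition is_pgroup (p : nat) (G : groupType) : Prop :=
  forall x : G, exists k : nat, has_order x (p ^ k).

(* The elements are the finitely supported functions G -> R. The product that
   [monalg] puts on [{malg R[G]}] is restricted to monoids with no nontrivial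
   unit, so the convolution product is defined here, on an alias. *)
Definition groupRing (R : nzRingType) (G : groupType) : Type := {malg R[G]}.
Bind Scope ring_scope with groupRing.

HB.instance Definition _ (R : nzRingType) (G : groupType) :=
  GRing.Lmodule.copy (groupRing R G) {malg R[G]}.

Section GroupRing.
Variables (R : nzRingType) (G : groupType).
Implicit Types (a b c : groupRing R G) (g h : G).

Definition gr_one : groupRing R G := mkmalgU 1%g 1.

(* (sum_g a_g g) (sum_h b_h h) = sum_(g, h) (a_g b_h) (g h) *)
Definition gr_mul a b : groupRing R G :=
  \sum_(g <- msupp a) \sum_(h <- msupp b)
    mkmalgU (g * h)%g (mcoeff g a * mcoeff h b).

Lemma gr_mulEw (d1 d2 : {fset G}) a b : msupp a `<=` d1 -> msupp b `<=` d2 ->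
  gr_mul a b = \sum_(g <- d1) \sum_(h <- d2)
    mkmalgU (g * h)%g (mcoeff g a * mcoeff h b).
Proof.
move=> le_d1 le_d2; rewrite /gr_mul (big_fset_incl _ le_d1) /=.
  apply/eq_bigr=> g _; apply/big_fset_incl => // h _ /mcoeff_outdom ->.
  by rewrite mulr0 monalgU0.
move=> g _ /mcoeff_outdom ag.
by rewrite big1 => // h _; rewrite ag mul0r monalgU0.
Qed.

Lemma gr_mul0l : left_zero 0 gr_mul.
Proof. by move=> a; rewrite /gr_mul msupp0 big_seq_fset0. Qed.

Lemma gr_mul0r : right_zero 0 gr_mul.
Proof.
by move=> a; rewrite /gr_mul big1 // => g _; rewrite msupp0 big_seq_fset0.
Qed.

Lemma gr_mulUU (x y : R) g h :
  gr_mul (mkmalgU g x) (mkmalgU h y) = mkmalgU (g * h)%g (x * y).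
Proof. by rewrite (gr_mulEw msuppU_le msuppU_le) !big_seq_fset1 !mcoeffUU. Qed.

Lemma gr_mulDl : left_distributive gr_mul +%R.
Proof.
move=> a b c.
rewrite (gr_mulEw (msuppD_le a b) (fsubset_refl (msupp c))).
rewrite (gr_mulEw (fsubsetUl (msupp a) (msupp b)) (fsubset_refl (msupp c))).
rewrite (gr_mulEw (fsubsetUr (msupp a) (msupp b)) (fsubset_refl (msupp c))).
rewrite -big_split /=; apply/eq_bigr=> g _.
rewrite -big_split /=; apply/eq_bigr=> h _.
by rewrite mcoeffD mulrDl monalgUD.
Qed.

Lemma gr_mulDr : right_distributive gr_mul +%R.
Proof.
move=> c a b.
rewrite (gr_mulEw (fsubset_refl (msupp c)) (msuppD_le a b)).
rewrite (gr_mulEw (fsubset_refl (msupp c)) (fsubsetUl (msupp a) (msupp b))).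
rewrite (gr_mulEw (fsubset_refl (msupp c)) (fsubsetUr (msupp a) (msupp b))).
rewrite -big_split /=; apply/eq_bigr=> g _.
rewrite -big_split /=; apply/eq_bigr=> h _.
by rewrite mcoeffD mulrDr monalgUD.
Qed.

Lemma gr_mul_suml (I : Type) (r : seq I) (F : I -> groupRing R G) b :
  gr_mul (\sum_(i <- r) F i) b = \sum_(i <- r) gr_mul (F i) b.
Proof.
exact: (big_morph (gr_mul^~ b) (fun x y => gr_mulDl x y b) (gr_mul0l b)).
Qed.

Lemma gr_mul_sumr (I : Type) (r : seq I) (F : I -> groupRing R G) a :
  gr_mul a (\sum_(i <- r) F i) = \sum_(i <- r) gr_mul a (F i).
Proof. exact: (big_morph (gr_mul a) (gr_mulDr a) (gr_mul0r a)). Qed.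

Lemma groupRingE a : a = \sum_(g <- msupp a) mkmalgU g (mcoeff g a).
Proof. exact: monalgE. Qed.

Lemma gr_mul1l : left_id gr_one gr_mul.
Proof.
move=> a; rewrite [in LHS](groupRingE a) gr_mul_sumr [RHS]groupRingE.
by apply/eq_bigr=> g _; rewrite gr_mulUU mul1g mul1r.
Qed.

Lemma gr_mul1r : right_id gr_one gr_mul.
Proof.
move=> a; rewrite [in LHS](groupRingE a) gr_mul_suml [RHS]groupRingE.
by apply/eq_bigr=> g _; rewrite gr_mulUU mulg1 mulr1.
Qed.

Lemma gr_mulA : associative gr_mul.
Proof.
move=> a b c; transitivity (\sum_(g <- msupp a) \sum_(h <- msupp b)
    \sum_(k <- msupp c)
      mkmalgU (g * h * k)%g (mcoeff g a * mcoeff h b * mcoeff k c)).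
  rewrite [in LHS](groupRingE a) gr_mul_suml; apply/eq_bigr=> g _.
  rewrite [in LHS](groupRingE b) (gr_mul_suml _ _ c) gr_mul_sumr;
  apply/eq_bigr=> h _.
  rewrite [in LHS](groupRingE c) (gr_mul_sumr _ _ (mkmalgU h _)) gr_mul_sumr;
  apply/eq_bigr=> k _.
  by rewrite !gr_mulUU mulrA mulgA.
rewrite [in RHS](groupRingE a) (gr_mul_suml _ _ b) gr_mul_suml;
  apply/eq_bigr=> g _.
rewrite [in RHS](groupRingE b) (gr_mul_sumr _ _ (mkmalgU g _)) gr_mul_suml;
  apply/eq_bigr=> h _.
rewrite gr_mulUU [in RHS](groupRingE c) gr_mul_sumr; apply/eq_bigr=> k _.
by rewrite gr_mulUU.
Qed.

Lemma gr_one_neq0 : gr_one != 0.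
Proof.
by apply/eqP=> /malgP/(_ 1%g)/eqP; rewrite mcoeffUU mcoeff0 oner_eq0.
Qed.

HB.instance Definition _ := GRing.Zmodule_isNzRing.Build (groupRing R G)
  gr_mulA gr_mul1l gr_mul1r gr_mulDl gr_mulDr gr_one_neq0.

End GroupRing.

(* Main.v *)
Require Import Defs.
From HB Require Import structures.
From mathcomp Require Import all_boot all_algebra.
From mathcomp Require Import finmap monalg boolp classical_sets.

Set Implicit Arguments.
Unset Strict Implicit.
Unset Printing Implicit Defensive.

(** In a 2-UQ ring [u ^+ 2 - 1] is quasi-nilpotent for every unit [u]; apply
    this to the elements [g] of [G].  If [g] has infinite order, then
    [1 - (g ^+ 2 - 1) g = 1 + g - g ^+ 3] is a unit of [RG]; since its extreme
    coefficients are invertible, comparing the coefficients of its inverse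
    along the powers of [g] gives a contradiction.  If [g] has finite order
    [2 ^ k * m] with [m > 1] odd, put [h = g ^+ 2 ^ k.+1], so that [h <> 1] and
    [h ^+ m = 1], and let [s] be the sum of the powers of [h].  Then [m - s] is
    a multiple of [h - 1], so [1 - m + s] is a unit; it sends [h - 1] to
    [(1 - m) (h - 1)], hence [h - 1] lies in [2 RG].  Its coefficient at [h]
    being [1], the element [2] is invertible in [R], against [2] in [J(R)]. *)

Import GRing.Theory.
Local Open Scope ring_scope.

Section RingLemmas.
Variable S : pzRingType.

(* Zorn's lemma is applied to sets closed under sums and left multiples that
   avoid 1; unlike the proper left ideals, they include the empty set, the
   union of the empty chain. *)
Lemma exists_maximal_left_ideal :
  (1 : S) <> 0 -> exists I : set S, maximal_left_ideal I.
Proof.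
move=> nz1.
pose P (I : set S) := [/\ forall x y, I x -> I y -> I (x + y),
  forall r x, I x -> I (r * x) & ~ I 1].
have [F FP Ftot|A [[AD AM A1] Amax]] := @Zorn_bigcup _ P.
  split.
  - move=> x y [X FX Xx] [Y FY Yy].
    have [XY|YX] := Ftot _ _ FX FY.
      by exists Y => //; have [YD _ _] := FP _ FY; apply: YD => //; apply: XY.
    by exists X => //; have [XD _ _] := FP _ FX; apply: XD => //; apply: YX.
  - by move=> r x [X FX Xx]; exists X => //; have [_ XM _] := FP _ FX; apply: XM.
  - by move=> [X FX X1]; have [_ _] := FP _ FX.
(* If 0 were not in [A], then [A] would be empty, as [0 * x = 0], and the zero ideal would properly
   contain it. *)
have A0 : A 0.
  apply: contrapT => nA0; apply: (Amax [set 0]%classic).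
    split; first by move=> x Ax; case: nA0; rewrite -(mul0r x); apply: AM.
    by move=> /(_ 0 erefl).
  split=> [x y /= -> ->|r x /= ->|/=]; by rewrite ?addr0 ?mulr0.
exists A; split; first by split.
  by move=> AT; apply: A1; rewrite AT.
move=> K [K0 KD KM] AK KT; apply: contrapT => KA.
apply: (Amax K).
  split=> // KsA; apply: KA; apply/seteqP; by split.
split=> // K1; apply: KT; apply/seteqP; split=> // x _.
by rewrite -(mulr1 x); apply: KM.
Qed.

Lemma jacobson_not_linv (a b : S) :
  (1 : S) <> 0 -> jacobson S a -> b * a <> 1.
Proof.
move=> nz1 Ja ba1; have [I maxI] := exists_maximal_left_ideal nz1.
have Ia := Ja _ maxI; case: maxI => -[I0 ID IM] IT _.
apply: IT; apply/seteqP; split=> // x _.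
by rewrite -(mulr1 x) -ba1; apply: (IM); apply: IM.
Qed.

Lemma unit_idempotent (e : S) : units S e -> e * e = e -> e = 1.
Proof. by move=> [v [ev _]] ee; rewrite -ev -{2}ee -mulrA ev mulr1. Qed.

(** With [f = 1 - e] and [w] the inverse of [u ^+ 2], [f * e = 0] gives [q * (f * w) = f]. Since
    [f * w] commutes with [q], [e = 1 - f] is a unit, and an idempotent unit is 1. *)
Lemma two_UQ_quasi_nilpotent (u : S) :
  two_UQ S -> units S u -> quasi_nilpotent S (u ^+ 2 - 1).
Proof.
move=> uq uU; have [v [uv vu]] := uU.
have [e [q [ee qn eq u2]]] := uq u uU.
suff e1 : e = 1 by rewrite u2 e1 addrC addKr.
have [w] : exists2 w, u ^+ 2 * w = 1 & w * u ^+ 2 = 1.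
  exists (v ^+ 2); first by rewrite !expr2 mulrA -(mulrA u) uv mulr1.
  by rewrite !expr2 mulrA -(mulrA v) vu mulr1.
move: (u ^+ 2) u2 => t tE tw wt; pose f := 1 - e.
have fq : f * q = q * f by rewrite /f mulrBl mulrBr mul1r mulr1 eq.
have qt : q * t = t * q by rewrite tE mulrDl mulrDr eq.
have qw : q * w = w * q.
  by rewrite -[LHS]mul1r -wt -mulrA (mulrA t) -qt -!mulrA tw mulr1.
have ft : f * t = f * q by rewrite tE mulrDr {1}/f mulrBl mul1r ee subrr add0r.
have qfw : q * (f * w) = f by rewrite mulrA -fq -ft -mulrA tw mulr1.
apply: unit_idempotent (ee); have -> : e = 1 - q * (f * w).
  by rewrite qfw /f subKr.
by apply: qn; rewrite mulrA -fq -!mulrA qw.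
Qed.

Lemma quasi_nilpotent_odd_order (h : S) (m : nat) :
  quasi_nilpotent S (h - 1) -> h ^+ m = 1 -> odd m ->
  exists r, h - 1 = r *+ 2.
Proof.
move=> qn hm odd_m.
pose s : S := \sum_(i < m) h ^+ i.
(* Each inner sum is the quotient of [h ^+ i - 1] by [h - 1]. *)
pose x : S := - \sum_(i < m) \sum_(j < i) h ^+ j.
have hs : (h - 1) * s = 0 by rewrite -subrX1 hm subrr.
have hx : (h - 1) * x = m%:R - s.
  rewrite mulrN mulr_sumr; under eq_bigr do rewrite -subrX1.
  by rewrite sumrB sumr_const card_ord opprB.
have cx : (h - 1) * x = x * (h - 1).
  have ch : GRing.comm (h - 1) h by rewrite /GRing.comm mulrBl mulrBr mul1r mulr1.
  apply: commrN; apply: commr_sum => i _; apply: commr_sum => j _.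
  exact: commrX.
have [v [uv _]] := qn _ cx; rewrite hx in uv.
(* [h - 1] kills [s], and [1 - m] is even. *)
have hu : (h - 1) * (1 - (m%:R - s)) = - (h - 1) *+ (m./2 * 2).
  rewrite mulrBr [X in _ - X]mulrBr hs subr0 mulr1 mulr_natr.
  rewrite -{1}[m]odd_double_half odd_m mulrnDr mulr1n opprD addrA subrr sub0r.
  by rewrite mulNrn muln2.
exists (- (h - 1) * v *+ m./2).
by rewrite -[LHS]mulr1 -[X in _ * X = _]uv mulrA hu mulrnAl mulrnA.
Qed.

End RingLemmas.

Section GroupRingLemmas.
Variables (R : nzRingType) (G : groupType).
Implicit Types (g h x : G) (v : groupRing R G).

Definition gr_of g : groupRing R G := mkmalgU g 1.

Lemma gr_ofM g h : gr_of (g * h)%g = gr_of g * gr_of h.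
Proof. by rewrite /gr_of [RHS]gr_mulUU mulr1. Qed.

Lemma gr_of1 : gr_of 1%g = 1. Proof. by []. Qed.

Lemma gr_ofX g n : gr_of (g ^+ n)%g = gr_of g ^+ n.
Proof. by elim: n => [|n IHn] //; rewrite expgS exprS gr_ofM IHn. Qed.

Lemma gr_of_unit g : units (groupRing R G) (gr_of g).
Proof. by exists (gr_of g^-1%g); rewrite -!gr_ofM mulgV mulVg. Qed.

Lemma mcoeff_gr_of g x : mcoeff x (gr_of g) = (g == x)%:R.
Proof. by rewrite mcoeffU. Qed.

Lemma mcoeff_gr_ofM g x v : mcoeff x (gr_of g * v) = mcoeff (g^-1 * x)%g v.
Proof.
rewrite {1}(groupRingE v) mulr_sumr [in RHS](groupRingE v) !raddf_sum /=.
apply: eq_bigr => h _; rewrite [gr_of g * _]gr_mulUU mul1r !mcoeffU.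
by rewrite -(inj_eq (mulgI g^-1%g)) mulKg.
Qed.

(** Each of the finitely many points of the support is met at most once. *)
Lemma mcoeff_eventually0 (a : nat -> G) v : injective a ->
  exists N, forall n, (N <= n)%N -> mcoeff (a n) v = 0.
Proof.
move=> inj_a.
suff [N HN] : exists N, forall n, (N <= n)%N -> a n \notin enum_fset (msupp v).
  by exists N => n /HN/mcoeff_outdom.
elim: (enum_fset (msupp v)) => [|x s [N HN]]; first by exists 0%N.
have [[k ak]|nk] := pselect (exists k, a k = x).
  exists (maxn N k.+1) => n; rewrite geq_max inE negb_or => /andP[Nn kn].
  by rewrite HN // andbT -ak (inj_eq inj_a) gtn_eqF.
exists N => n Nn; rewrite inE negb_or HN // andbT.
by apply/eqP => an; apply: nk; exists n.
Qed.

Lemma quasi_nilpotent_torsion g :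
  quasi_nilpotent _ (gr_of g ^+ 2 - 1) -> exists2 n, (0 < n)%N & (g ^+ n)%g = 1%g.
Proof.
move=> qn; apply: contrapT => tf.
have inj_g : injective (fun n => g ^+ n)%g.
  move=> i j /= gij; wlog ij : i j gij / (i < j)%N.
    by move=> W; case: (ltngtP i j) => // [/W->|/W->].
  case: tf; exists (j - i)%N; first by rewrite subn_gt0.
  by apply: (mulgI (g ^+ i)%g); rewrite -expgnDr subnKC ?mulg1 // ltnW.
have inj_gV : injective (fun n => g ^- n)%g by move=> i j /invg_inj/inj_g.
have uE : 1 - (gr_of g ^+ 2 - 1) * gr_of g = 1 + gr_of g - gr_of (g ^+ 3)%g.
  by rewrite gr_ofX mulrBl mul1r -exprSr opprB addrA.
have [] := qn (gr_of g).
  by rewrite mulrBl mulrBr mul1r mulr1 -exprS -exprSr.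
rewrite {}uE => v [uv _].
have [N HN] := mcoeff_eventually0 v inj_gV.
(* [d j] is the coefficient of [v] at [g] to the power [j - K]. *)
pose K := N.+3; pose d j := mcoeff (g ^+ j * g ^- K)%g v.
(* This compares the coefficients at exponent [j + 3 - K] in [(1 + g - g ^+ 3) v = 1]. *)
have dS j : d j.+3 + d j.+2 - d j = (j.+3 == K)%:R.
  have /(congr1 (mcoeff (g ^+ j.+3 * g ^- K)%g)) := uv.
  rewrite mulrBl mulrDl mul1r mcoeffB mcoeffD !mcoeff_gr_ofM -gr_of1 mcoeff_gr_of.
  have shift k i y : (g ^- k * (g ^+ (k + i) * y) = g ^+ i * y)%g.
    by rewrite expgnDr -mulgA mulKg.
  rewrite (shift 1%N j.+2) (shift 3%N j) /d => ->; congr (nat_of_bool _)%:R.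
  by rewrite -(inj_eq (mulIg (g ^+ K)%g)) mul1g mulgVK eq_sym (inj_eq inj_g).
(* The choice [K = N + 3] makes [K - i >= N] here, so [HN] applies. *)
have d_init i : (i < 3)%N -> d i = 0.
  move=> i3; have iK : (i <= K)%N by rewrite ltnW // (leq_trans i3).
  rewrite /d -[in X in (_ / X)%g](subnK iK) expgnDr invgM mulVKg HN //.
  by rewrite leq_subRL // -[K]/(3 + N)%N leq_add2r ltnW.
have d_low j : (j < K)%N -> d j = 0.
  elim/ltn_ind: j => -[|[|[|j]]] IH jK; [exact: d_init..|].
  have jK2 : (j.+2 < K)%N by exact: ltnW.
  have jK1 : (j < K)%N by do 2!apply: ltnW.
  have := dS j; rewrite (ltn_eqF jK) (IH j) ?(IH j.+2) ?subr0 ?addr0 //.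
  by do 2!apply: ltnW.
have inj_d : injective (fun n => g ^+ n * g ^- K)%g by move=> i j /mulIg/inj_g.
have [B HB] := mcoeff_eventually0 v inj_d.
(* The recurrence is now run downwards from [B]; it is homogeneous because [j + 3 > K]. *)
have d_high i j : (K <= j)%N -> (B <= j + i)%N -> d j = 0.
  elim: i j => [|i IH] j Kj Bij; first by rewrite /d HB // -(addn0 j).
  have Kj2 : (K <= j.+2)%N by do 2!apply: leqW.
  have Bij2 : (B <= j.+2 + i)%N by rewrite !addSn leqW // -addnS.
  have := dS j; rewrite gtn_eqF // (IH j.+2) // (IH j.+3 (leqW Kj2) (leqW Bij2)).
  by move/eqP; rewrite addr0 sub0r oppr_eq0 => /eqP.
(* At [j = N] the right-hand side is 1, while all three terms on the left vanish. *)
have := dS N; rewrite eqxx (d_low N.+2) // (d_low N); last by do 2!apply: ltnW.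
rewrite (d_high B) ?leq_addl //.
by move/esym/eqP; rewrite subr0 addr0 oner_eq0.
Qed.

End GroupRingLemmas.

Theorem proposition4p3 (R : nzRingType) (G : groupType) :
  jacobson R 2%:R -> two_UQ (groupRing R G) -> is_pgroup 2 G.
Proof.
move=> J2 uq g.
have qn (x : G) : quasi_nilpotent _ (gr_of R x ^+ 2 - 1).
  by apply: two_UQ_quasi_nilpotent => //; apply: gr_of_unit.
have ex_n : exists n, (0 < n)%N && ((g ^+ n)%g == 1%g).
  have [n n0 gn] := quasi_nilpotent_torsion (qn g).
  by exists n; rewrite n0 gn eqxx.
case: (ex_minnP ex_n) => n /andP[n0 /eqP gn] n_min.
have [k [m odd_m nE]] : exists k, exists2 m, odd m & n = (2 ^ k * m)%N.
  have [m cop nE] := pfactor_coprime (isT : prime 2) n0.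
  by exists (logn 2 n), m; rewrite -?coprime2n // mulnC.
exists k.
have pk0 : (0 < 2 ^ k)%N by rewrite expn_gt0.
have [gk|gk] := eqVneq (g ^+ (2 ^ k))%g 1%g.
  split=> // i i0 gi; apply: leq_trans (n_min i _); last by rewrite i0 gi eqxx.
  by rewrite nE leq_pmulr // odd_gt0.
(* Being a square, [h] is covered by [qn]. *)
pose h := (g ^+ (2 ^ k) ^+ 2)%g.
have hm : (h ^+ m = 1)%g by rewrite /h expgnAC -(expgnA g) -nE gn expg1n.
have h1 : h != 1%g.
  (* If [h = 1], the odd power [m] of [g ^+ (2 ^ k)], which is 1, is that element itself. *)
  apply: contraNneq gk => h1; move: gn; rewrite nE expgnA.
  rewrite -{1}[m]odd_double_half odd_m expgS -mul2n expgnA -/h h1 expg1n mulg1.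
  by move=> ->.
have [r] : exists r, gr_of R h - 1 = r *+ 2.
  apply: quasi_nilpotent_odd_order odd_m; last by rewrite -gr_ofX hm.
  by rewrite gr_ofX; apply: qn.
move/(congr1 (mcoeff h)).
rewrite mcoeffB -gr_of1 !mcoeff_gr_of eqxx eq_sym (negPf h1) subr0 mcoeffMn.
rewrite -[RHS]mulr_natr => /esym r2; case: (jacobson_not_linv _ J2 r2).
exact/eqP/oner_neq0.
Qed.
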